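(* Let $F$ be a field, $k\ge 1$, and let $d_1,\ldots,d_k\in F$ be nonzero. Let $A=F^k$ be the algebra of $k\times k$ diagonal matrices over $F$, with trace function $tr(a_1,\ldots,a_k)=d_1a_1+\cdots+d_ka_k$. Then there exists an integer $m\ge 1$ such that $A$ satisfies a trace identity of the form $$tr(y_1)tr(y_2)\cdots tr(y_m)=\text{an } F\text{-linear combination of trace terms in } y_1,\ldots,y_m, \text{ each a product of fewer than } m \text{ traces}.$$
   Context: A trace term in $y_1,\ldots,y_m$ is a product $tr(w_1)tr(w_2)\cdots tr(w_r)$, $r\ge1$, where each $w_j$ is a non-empty monomial in the variables $y_1,\ldots,y_m$; it is a product of $r$ traces. That $A$ satisfies a trace identity means that the equality holds for all substitutions of elements of $A$ for $y_1,\ldots,y_m$ (formally, also for generic diagonal matrices, i.e. $y_i=\mathrm{diag}(y_{i1},\ldots,y_{ik})$ with $y_{ij}$ independent commuting indeterminates, and $tr$ extended linearly). *)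

(* Defs.v *)
From mathcomp Require Import all_boot all_order all_algebra.
From mathcomp Require Import mpoly.
Set Implicit Arguments.
Unset Strict Implicit.
Unset Printing Implicit Defensive.
Import GRing.Theory.
Local Open Scope ring_scope.

(* A monomial is a word in the variables, a trace term
   tr(w_1) ... tr(w_r) is the list of its words. *)
Definition monomial (m : nat) := seq 'I_m.

Definition trace_prod (m : nat) := seq (monomial m).

Definition is_trace_term (m : nat) (t : trace_prod m) : bool :=
  (t != [::]) && all (fun w => w != [::]) t.

Definition num_traces (m : nat) (t : trace_prod m) : nat := size t.

(* Formal F-linear combinations, as lists of pairs (coefficient, term). *)
Definition trace_poly (F : fieldType) (m : nat) := seq (F * trace_prod m).

Definition wtrace (R : comNzRingType) (k : nat) (d : 'I_k -> R)
    (a : 'M[R]_k) : R :=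
  \sum_(j < k) d j * a j j.

Definition eval_monomial (R : comNzRingType) (k m : nat)
    (y : 'I_m -> 'M[R]_k) (w : monomial m) : 'M[R]_k :=
  \prod_(i <- w) y i.

Definition eval_trace_prod (R : comNzRingType) (k m : nat) (d : 'I_k -> R)
    (y : 'I_m -> 'M[R]_k) (t : trace_prod m) : R :=
  \prod_(w <- t) wtrace d (eval_monomial y w).

(* [phi] embeds the scalars F in R; both the coefficients of [p] and the
   weights [d] are transported along it, so that the trace is the R-linear
   extension of the one over F. *)
Definition eval_trace_poly (F : fieldType) (R : comNzRingType)
    (phi : {rmorphism F -> R}) (k m : nat) (d : 'I_k -> F)
    (y : 'I_m -> 'M[R]_k) (p : trace_poly F m) : R :=
  \sum_(ct <- p) phi ct.1 * eval_trace_prod (fun j => phi (d j)) y ct.2.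

(* y_i = diag(y_i1, ..., y_ik), the m * k entries being independent
   indeterminates; [mxvec_index] is a bijection 'I_m * 'I_k -> 'I_(m * k). *)
Definition generic_diag (F : fieldType) (k m : nat) (i : 'I_m) :
    'M[{mpoly F[m * k]}]_k :=
  diag_mx (\row_(j < k) 'X_(mxvec_index i j)).

(* Over a finite field the generic equality is stronger than the equality
   for all substitutions from the algebra; both are required. *)
Definition satisfies_trace_identity (F : fieldType) (k m : nat)
    (d : 'I_k -> F) (f g : trace_poly F m) : Prop :=
  (forall y : 'I_m -> 'M[F]_k, (forall i, is_diag_mx (y i)) ->
     eval_trace_poly idfun d y f = eval_trace_poly idfun d y g)
  /\ eval_trace_poly (@mpolyC (m * k) F) d (@generic_diag F k m) f
     = eval_trace_poly (@mpolyC (m * k) F) d (@generic_diag F k m) g.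

(* tr(y_1) tr(y_2) ... tr(y_m) *)
Definition prod_of_traces (F : fieldType) (m : nat) : trace_poly F m :=
  [:: (1, [seq [:: i] | i <- enum 'I_m])].

(* Main.v *)
Require Import Defs.
From mathcomp Require Import all_boot all_order all_algebra perm.
From mathcomp Require Import mpoly.
Set Implicit Arguments.
Unset Strict Implicit.
Unset Printing Implicit Defensive.
Import GRing.Theory.
Local Open Scope ring_scope.

(** The elements of [C] are called colors; a diagonal matrix assigns a scalar
to each color, and [tr d y w] is the weighted trace of the word [w].  All
identities are required for every commutative ring [R] over [F] and every
assignment [y]; this covers both the substitutions from [F^k] and the generic
diagonal matrices.  The proof is an induction on the number of colors of
nonzero weight, and it works in every characteristic.

Call an expression leading ([lead]) if it is a product of the traces of [m]
distinct variables plus products of fewer traces of words in these variables.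
Products of leading expressions in disjoint variables are leading, so it is
enough to find a leading expression in [m] variables, with [m] large, that can
be rewritten with a number of traces bounded independently of [m].

- Deleting a color [j], or merging two colors [j] and [l] into one of weight
  [d j + d l], decreases the number of nonzero weights.  The induction
  hypothesis thus provides leading expressions that vanish as soon as
  coordinate [j] vanishes, or as soon as coordinates [j] and [l] agree
  ([lead_of_identity]).

- Let [G1] be a product of expressions of the first kind, for all [j].  Its
  monomials involve all colors, so the group [stab d] of permutations of the
  colors that preserve the weights acts freely on them, and [G1] is the sum of
  the translates of a multilinear polynomial [f] under this group
  ([lead_transfer]); no division by the order of the group is involved.

- Consider a sum over all maps [s : C -> C], with weights [prod_l d (s l)], of
  polynomials in the recolored variables [y i (s j)].  Each monomial
  contributes a product of at most [#|C|] traces, because the sum factors over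
  the colors ([ev_of_mixed]).  Apply this to the polynomial [f] times a
  product of [separator]s, which are built from expressions of the second kind
  and involve at most one further trace each.  The separators kill all [s]
  that are not in [stab d], and on [stab d] they take a value that does not
  depend on [s]: it is a nonzero constant times a leading expression.  The sum
  over [stab d] turns [f] back into [G1], and therefore a leading expression
  equals an expression with at most [#|C|^2 + #|C|] traces
  ([averaging_identity], [trace_identity_step]).  The number [m] is made
  larger than this bound by taking enough factors in [G1]. *)

(** * Formal trace polynomials and their values *)

Definition word := seq nat.
Definition term := seq word.
Definition tpoly (F : fieldType) := seq (F * term).

Section Evaluation.
Variables (F : fieldType) (C : finType).
Implicit Types (d : C -> F) (w : word) (t : term) (p q : tpoly F).

(** Words may be empty here, with trace the sum of the weights; this is what a
color absent from a monomial contributes in [ev_of_mixed]. *)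
Definition tr (R : comNzRingType) (phi : {rmorphism F -> R}) d
    (y : nat -> C -> R) w : R :=
  \sum_j phi (d j) * \prod_(i <- w) y i j.

Definition ev_term (R : comNzRingType) (phi : {rmorphism F -> R}) d
    (y : nat -> C -> R) t : R :=
  \prod_(w <- t) tr phi d y w.

Definition ev (R : comNzRingType) (phi : {rmorphism F -> R}) d
    (y : nat -> C -> R) p : R :=
  \sum_(ct <- p) phi ct.1 * ev_term phi d y ct.2.

(** Functions defined uniformly over all rings [R], such as trace polynomials:
a property of such a function can be tested in any [R]. *)
Definition ufun := forall R : comNzRingType, {rmorphism F -> R} ->
  (nat -> C -> R) -> R.

Lemma eq_tr (R : comNzRingType) (phi : {rmorphism F -> R}) d
    (y y' : nat -> C -> R) w :
  (forall i j, i \in w -> y i j = y' i j) -> tr phi d y w = tr phi d y' w.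
Proof.
move=> eqy; apply: eq_bigr => j _; congr (_ * _).
by apply: eq_big_seq => i iw; apply: eqy.
Qed.

Lemma ev_term_cat R phi d y t1 t2 :
  @ev_term R phi d y (t1 ++ t2) = ev_term phi d y t1 * ev_term phi d y t2.
Proof. by rewrite /ev_term big_cat. Qed.

Lemma ev_cat R phi d y p q : @ev R phi d y (p ++ q) = ev phi d y p + ev phi d y q.
Proof. by rewrite /ev big_cat. Qed.

Lemma ev_cons R phi d y ct p :
  @ev R phi d y (ct :: p) = phi ct.1 * ev_term phi d y ct.2 + ev phi d y p.
Proof. by rewrite /ev big_cons. Qed.

Definition tpoly_scale (c : F) p : tpoly F := [seq (c * ct.1, ct.2) | ct <- p].

Lemma ev_scale R phi d y c p : @ev R phi d y (tpoly_scale c p) = phi c * ev phi d y p.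
Proof.
rewrite /ev big_map mulr_sumr; apply: eq_bigr => ct _ /=.
by rewrite rmorphM mulrA.
Qed.

Definition tpoly_mul p q : tpoly F :=
  [seq (a.1 * b.1, a.2 ++ b.2) | a <- p, b <- q].

Lemma ev_mul R phi d y p q :
  @ev R phi d y (tpoly_mul p q) = ev phi d y p * ev phi d y q.
Proof.
rewrite /ev big_allpairs_dep mulr_suml; apply: eq_bigr => a _.
rewrite mulr_sumr; apply: eq_bigr => b _ /=.
by rewrite rmorphM ev_term_cat mulrACA.
Qed.

Definition shift_poly o p : tpoly F :=
  [seq (ct.1, [seq [seq (o + i)%N | i <- w] | w <- ct.2]) | ct <- p].

Lemma ev_shift R phi d y o p :
  @ev R phi d y (shift_poly o p) = ev phi d (fun i => y (o + i)%N) p.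
Proof.
rewrite /ev big_map; apply: eq_bigr => ct _ /=; congr (_ * _).
rewrite /ev_term big_map; apply: eq_bigr => w _.
by apply: eq_bigr => j _; rewrite big_map.
Qed.

(** Multiplying the variable [y i] by an indeterminate ['X] multiplies each
term by the power of ['X] that counts the occurrences of [i]; the coefficients
of each power of ['X] therefore vanish separately. *)
Lemma ev_count_filter d q i n :
  (forall R phi y, @ev R phi d y q = 0) ->
  forall R phi y,
    @ev R phi d y [seq ct <- q | count_mem i (flatten ct.2) == n] = 0.
Proof.
move=> q0 R phi y.
pose psi : {rmorphism F -> {poly R}} := polyC \o phi.
pose y' a j : {poly R} := if a == i then (y a j)%:P * 'X else (y a j)%:P.
have trE w : tr psi d y' w = (tr phi d y w)%:P * 'X^(count_mem i w).
  rewrite /tr rmorph_sum mulr_suml; apply: eq_bigr => j _.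
  rewrite rmorphM -mulrA; congr (_ * _).
  elim: w => [|a w IHw]; first by rewrite !big_nil /= expr0 mulr1.
  rewrite !big_cons IHw /= /y' rmorphM; case: eqP => _ /=.
    by rewrite add1n exprS mulrACA.
  by rewrite add0n mulrA.
have evtE t : ev_term psi d y' t = (ev_term phi d y t)%:P * 'X^(count_mem i (flatten t)).
  rewrite /ev_term; elim: t => [|w t IHt]; first by rewrite !big_nil /= expr0 mulr1.
  by rewrite !big_cons IHt trE /= count_cat exprD rmorphM mulrACA.
have /(congr1 (fun u : {poly R} => u`_n)) := q0 _ psi y'.
rewrite coef0 => <-; rewrite /ev coef_sum big_filter big_mkcond.
apply: eq_bigr => ct _; rewrite evtE /= mulrA -rmorphM coefCM coefXn eq_sym.
by case: eqP; rewrite ?mulr1 ?mulr0.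
Qed.

(** The number of occurrences is prescribed successively for each variable of
[q] and each variable below [m]. *)
Lemma ev_multilinear_part d q m :
  (forall R phi y, @ev R phi d y q = 0) ->
  forall R phi y,
    @ev R phi d y [seq ct <- q | perm_eq (flatten ct.2) (iota 0 m)] = 0.
Proof.
move=> q0.
have step (r : seq nat) : forall R phi y, @ev R phi d y [seq ct <- q |
    all (fun i => count_mem i (flatten ct.2) == count_mem i (iota 0 m)) r] = 0.
  elim: r => [|i r IHr] R phi y; first by rewrite /= filter_predT.
  by rewrite /= filter_predI; apply: ev_count_filter.
move=> R phi y.
pose r := flatten [seq flatten ct.2 | ct <- q] ++ iota 0 m.
rewrite -[RHS](step r R phi y); congr (ev _ _ _ _); apply: eq_in_filter => ct ctq.
apply/idP/allP => [/seq.permP eqc i _| H]; first by rewrite eqc.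
apply/allP => i; rewrite mem_cat => imem; apply: H.
rewrite mem_cat; case/orP: imem => [imem|->]; last by rewrite orbT.
by apply/orP; left; apply/flattenP; exists (flatten ct.2); [apply: map_f|].
Qed.

Definition remove_empty_words d (ct : F * term) : F * term :=
  (ct.1 * \prod_(w <- ct.2 | w == [::]) \sum_j d j, [seq w <- ct.2 | w != [::]]).

Lemma ev_remove_empty_words R phi d y p :
  @ev R phi d y [seq remove_empty_words d ct | ct <- p] = ev phi d y p.
Proof.
rewrite /ev big_map; apply: eq_bigr => ct _ /=.
rewrite rmorphM -mulrA; congr (_ * _).
rewrite /ev_term big_filter [RHS](bigID (fun w => w == [::])) /=; congr (_ * _).
rewrite rmorph_prod; apply: eq_bigr => w /eqP ->.
by rewrite /tr rmorph_sum; apply: eq_bigr => j _; rewrite big_nil mulr1.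
Qed.

Definition traces_of o m : term := [seq [:: i] | i <- iota o m].

(** The term is multilinear in [y o, ..., y (o + m - 1)], a product of fewer
than [m] traces of nonempty words.  The words must be nonempty because
the trace of the empty word changes when a color is deleted ([tr_drop]). *)
Definition lower_term o m t :=
  [&& (size t < m)%N, [::] \notin t & perm_eq (flatten t) (iota o m)].

(** A polynomial whose leading term is the product of the traces of
[y o, ..., y (o + m - 1)], and whose other terms are lower. *)
Definition trace_monic o m q :=
  exists p, q = (1, traces_of o m) :: p /\ all (fun ct => lower_term o m ct.2) p.

Definition trace_identity d :=
  exists m q, (0 < m)%N /\ trace_monic 0 m q /\
    forall R phi y, @ev R phi d y q = 0.
End Evaluation.

(** * Leading expressions *)

Section Monic.
Variables (F : fieldType) (C : finType).
Implicit Types (d : C -> F) (w : word) (t : term) (p q : tpoly F).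
Local Notation ufun := (ufun F C).

Lemma flatten_traces_of o m : flatten (traces_of o m) = iota o m.
Proof. by rewrite /traces_of; elim: (iota o m) => //= i s ->. Qed.

Lemma traces_of_nonempty o m : [::] \notin traces_of o m.
Proof. by apply/mapP => -[]. Qed.

Lemma traces_of_cat o m m' :
  traces_of o m ++ traces_of (o + m) m' = traces_of o (m + m').
Proof. by rewrite /traces_of iotaD map_cat. Qed.

Lemma size_traces_of o m : size (traces_of o m) = m.
Proof. by rewrite size_map size_iota. Qed.

Lemma tpoly_mul_cons (a b : F * term) p q :
  tpoly_mul (a :: p) (b :: q) = (a.1 * b.1, a.2 ++ b.2) ::
    [seq (a.1 * b'.1, a.2 ++ b'.2) | b' <- q] ++ tpoly_mul p (b :: q).
Proof. by []. Qed.

Lemma trace_monic_mul o m m' p q :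
  trace_monic o m p -> trace_monic (o + m) m' q -> trace_monic o (m + m') (tpoly_mul p q).
Proof.
move=> [p' [-> p'P]] [q' [-> q'P]].
exists (behead (tpoly_mul ((1, traces_of o m) :: p') ((1, traces_of (o + m) m') :: q'))).
split; first by rewrite /tpoly_mul /= mulr1 traces_of_cat.
have low_cat t t' : (size t + size t' < m + m')%N ->
    [::] \notin t -> [::] \notin t' ->
    perm_eq (flatten t) (iota o m) -> perm_eq (flatten t') (iota (o + m) m') ->
    lower_term o (m + m') (t ++ t').
  move=> lt nt nt' pt pt'; rewrite /lower_term size_cat lt mem_cat negb_or nt nt' /=.
  by rewrite flatten_cat iotaD perm_cat.
rewrite tpoly_mul_cons [behead _]/(_ ++ _) all_cat all_map; apply/andP; split.
  apply: sub_all q'P => -[c t] /and3P[/= lt nt pt].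
  apply: low_cat; rewrite ?size_traces_of ?traces_of_nonempty ?flatten_traces_of //.
  by rewrite ltn_add2l.
apply/allP => _ /allpairsPdep[[c t] [[c' t'] [/= tp tq ->]]] /=.
have /and3P[/= lt nt pt] := allP p'P _ tp.
have : [/\ (size t' <= m')%N, [::] \notin t' & perm_eq (flatten t') (iota (o + m) m')].
  move: tq; rewrite inE => /orP[/eqP[_ ->]|/(allP q'P)/and3P[/= lt' nt' pt']].
    by rewrite size_traces_of traces_of_nonempty flatten_traces_of.
  by split=> //; apply: ltnW.
case=> lt' nt' pt'; apply: low_cat => //.
exact: (leq_add lt lt').
Qed.

Lemma trace_monic0 o : trace_monic o 0 [:: (1 : F, [::])].
Proof. by exists [::]. Qed.

Lemma trace_monic_shift o m q : trace_monic 0 m q -> trace_monic o m (shift_poly o q).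
Proof.
have sE s : [seq (o + i)%N | i <- iota s m] = iota (o + s) m.
  by rewrite iotaDl.
have fE t : flatten [seq [seq (o + i)%N | i <- w] | w <- t] = [seq (o + i)%N | i <- flatten t].
  by elim: t => //= w t ->; rewrite map_cat.
move=> [p [-> pP]]; exists (shift_poly o p); split.
  rewrite /shift_poly /=; congr (_ :: _); congr (_, _).
  by rewrite /traces_of -map_comp -[in RHS](addn0 o) -sE -map_comp.
rewrite all_map; apply: sub_all pP => -[c t] /and3P[/= lt nt pt].
rewrite /lower_term size_map lt fE -{3}(addn0 o) -sE perm_map // andbT.
by apply/mapP => -[[|//] nil_t _]; rewrite nil_t in nt.
Qed.

Definition lead d o m (G : ufun) :=
  exists q, trace_monic o m q /\ forall R phi y, G R phi y = ev phi d y q.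

Lemma lead1 d o : lead d o 0 (fun R phi y => 1).
Proof.
exists [:: (1, [::])]; split=> [|R phi y]; first exact: trace_monic0.
by rewrite /ev big_seq1 /ev_term big_nil rmorph1 mulr1.
Qed.

Lemma lead_mul d o m m' (G G' : ufun) :
  lead d o m G -> lead d (o + m) m' G' ->
  lead d o (m + m') (fun R phi y => G R phi y * G' R phi y).
Proof.
move=> [q [qP qE]] [q' [qP' qE']]; exists (tpoly_mul q q').
split=> [|R phi y]; first exact: trace_monic_mul.
by rewrite ev_mul qE qE'.
Qed.

(** Each factor is placed on variables that follow those of the previous
factors, so that the variables of different factors are disjoint. *)
Lemma lead_prod d (J : eqType) (S : J -> ufun -> Prop) :
  (forall j o, exists m G, [/\ (0 < m)%N, lead d o m G & S j G]) ->
  forall (r : seq J) o, uniq r -> exists m (G : J -> ufun),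
    [/\ (size r <= m)%N, lead d o m (fun R phi y => \prod_(j <- r) G j R phi y)
      & forall j, j \in r -> S j (G j)].
Proof.
move=> SP; elim=> [|j r IHr] o /=.
  exists 0%N, (fun _ _ _ _ => 0); split=> //.
  have [q [qP qE]] := lead1 d o; exists q; split=> // R phi y.
  by rewrite big_nil -(qE R phi y).
case/andP=> jr ur.
have [m [G [m0 Gl GS]]] := SP j o.
have [m' [G' [m'r Gl' GS']]] := IHr (o + m)%N ur.
exists (m + m')%N, (fun i => if i == j then G else G' i); split.
- by rewrite -add1n leq_add.
- have [q [qP qE]] := lead_mul Gl Gl'; exists q; split=> // R phi y.
  rewrite big_cons eqxx -qE; congr (_ * _); apply: eq_big_seq => i ir.
  by case: eqP => // ij; rewrite -ij ir in jr.
- by move=> i; rewrite inE; case: eqP => [-> //|_ /=]; apply: GS'.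
Qed.

Lemma eq_ev_weights d d' o m q : trace_monic o m q ->
  forall R phi y, (forall w, w != [::] -> @tr F C R phi d y w = tr phi d' y w) ->
  ev phi d y q = ev phi d' y q.
Proof.
have evt R phi y t : (forall w, w != [::] -> @tr F C R phi d y w = tr phi d' y w) ->
    [::] \notin t -> ev_term phi d y t = ev_term phi d' y t.
  move=> trE nt; apply: eq_big_seq => w wt; apply: trE.
  by apply: contraNneq nt => <-.
move=> [p [-> pP]] R phi y trE; rewrite !ev_cons evt ?traces_of_nonempty //.
congr (_ + _); apply: eq_big_seq => ct /(allP pP)/and3P[_ nt _].
by rewrite evt.
Qed.

(** An identity for the weights [d'], read with the weights [d], need not
vanish, but it does so wherever both families of weights give the same traces. *)
Lemma lead_of_identity d d' : trace_identity d' ->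
  forall o, exists m G, [/\ (0 < m)%N, lead d o m G &
    forall R phi y, (forall w, w != [::] -> tr phi d y w = tr phi d' y w) ->
    G R phi y = 0].
Proof.
move=> [m [q [m0 [qm q0]]]] o.
exists m, (fun R phi y => ev phi d y (shift_poly o q)); split=> //.
  by exists (shift_poly o q); split=> //; apply: trace_monic_shift.
move=> R phi y trE; rewrite (eq_ev_weights (trace_monic_shift o qm) trE).
by rewrite ev_shift q0.
Qed.

Definition merge_colors d j l c :=
  if c == l then 0 else if c == j then d j + d l else d c.

Lemma tr_merge (R : comNzRingType) (phi : {rmorphism F -> R}) d (y : nat -> C -> R) j l w :
  j != l -> (forall i, y i j = y i l) ->
  tr phi d y w = tr phi (merge_colors d j l) y w.
Proof.
move=> jl yE; have wE : \prod_(i <- w) y i l = \prod_(i <- w) y i j.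
  by apply: eq_bigr.
rewrite /tr (bigD1 l) //= (bigD1 j) //= addrA [in RHS](bigD1 l) //= [in RHS](bigD1 j) //=.
rewrite /merge_colors eqxx (negbTE jl) eqxx rmorph0 mul0r add0r wE -mulrDl -rmorphD [d l + _]addrC.
by congr (_ + _); apply: eq_bigr => c /andP[/negbTE-> /negbTE->].
Qed.

Definition drop_color d j c := if c == j then 0 else d c.

Lemma tr_drop (R : comNzRingType) (phi : {rmorphism F -> R}) d (y : nat -> C -> R) j w :
  w != [::] -> (forall i, y i j = 0) ->
  tr phi d y w = tr phi (drop_color d j) y w.
Proof.
case: w => // i w _ y0; apply: eq_bigr => c _; rewrite /drop_color.
by case: eqP => // ->; rewrite big_cons y0 mul0r !mulr0.
Qed.

Lemma ev_perm d (s : {perm C}) q : (forall j, d (s j) = d j) ->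
  forall R phi y, @ev F C R phi d (fun i j => y i (s j)) q = ev phi d y q.
Proof.
move=> ds R phi y; apply: eq_bigr => ct _; congr (_ * _).
apply: eq_bigr => w _; rewrite /tr [RHS](reindex_inj (@perm_inj _ s)).
by apply: eq_bigr => j _; rewrite ds.
Qed.

Lemma lead_perm d o m G (s : {perm C}) : lead d o m G ->
  (forall j, d (s j) = d j) ->
  forall R phi y, G R phi (fun i j => y i (s j)) = G R phi y.
Proof. by move=> [q [_ qE]] ds R phi y; rewrite !qE (ev_perm _ ds). Qed.
End Monic.

(** * Leading expressions as sums over a group of permutations *)

Section Transfer.
Variables (F : fieldType) (C : finType).
Implicit Types (d : C -> F) (w : word) (t : term) (p q : tpoly F).
Local Notation ufun := (ufun F C).

Definition color_expansion m (a : {ffun 'I_m -> C} -> F) : ufun :=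
  fun R phi y => \sum_g phi (a g) * \prod_(i < m) y i (g i).

Lemma ev_term_expand d (c0 : C) t : uniq (flatten t) ->
  exists l : seq (F * (nat -> C)), forall R phi y,
    @ev_term F C R phi d y t =
    \sum_(x <- l) phi x.1 * \prod_(i <- flatten t) y i (x.2 i).
Proof.
elim: t => [|w t IHt] /=.
  exists [:: (1, fun=> c0)] => R phi y.
  by rewrite big_seq1 rmorph1 big_nil mul1r /ev_term big_nil.
rewrite cat_uniq => /and3P[_ wt /IHt[l lE]].
exists [seq (d j * x.1, fun i => if i \in w then j else x.2 i) | j <- enum C, x <- l].
move=> R phi y; rewrite /ev_term big_cons -/(ev_term phi d y t) lE.
rewrite big_allpairs_dep /tr mulr_suml big_enum; apply: eq_bigr => j _.
rewrite mulr_sumr; apply: eq_bigr => x _ /=.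
rewrite rmorphM big_cat mulrACA; congr (_ * (_ * _)).
  by apply: eq_big_seq => i ->.
apply: eq_big_seq => i it; case: ifP => // iw.
by case/hasP: wt; exists i.
Qed.

Lemma multilinear_term_expand d (c0 : C) m t : perm_eq (flatten t) (iota 0 m) ->
  exists a, forall R phi y, ev_term phi d y t = @color_expansion m a R phi y.
Proof.
move=> pt; have ut : uniq (flatten t) by rewrite (perm_uniq pt) iota_uniq.
have [l lE] := ev_term_expand d c0 ut.
exists (fun h => \sum_(x <- l | [ffun i : 'I_m => x.2 i] == h) x.1) => R phi y.
rewrite lE /color_expansion.
under [RHS]eq_bigr do rewrite rmorph_sum big_mkcond mulr_suml.
rewrite exchange_big; apply: eq_bigr => x _ /=.
rewrite (bigD1 [ffun i : 'I_m => x.2 i]) //= eqxx [X in _ + X]big1 ?addr0; last first.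
  by move=> h /negbTE; rewrite eq_sym => ->; rewrite mul0r.
rewrite (perm_big _ pt) -[m in iota 0 m]subn0 -/(index_iota 0 m) big_mkord.
by congr (_ * _); apply: eq_bigr => i _; rewrite ffunE.
Qed.

Lemma lead_expand d (c0 : C) m G : lead d 0 m G ->
  exists a, forall R phi y, G R phi y = @color_expansion m a R phi y.
Proof.
move=> [q [[p [qE pP]] GE]].
have : all (fun ct => perm_eq (flatten ct.2) (iota 0 m)) q.
  rewrite qE /= flatten_traces_of perm_refl /=.
  by apply: sub_all pP => ct /and3P[].
suff aux : all (fun ct => perm_eq (flatten ct.2) (iota 0 m)) q ->
  exists a, forall R phi y, ev phi d y q = @color_expansion m a R phi y.
  by case/aux=> a aE; exists a => R phi y; rewrite GE aE.
elim: q {p qE pP GE} => [_|ct q IHq /= /andP[pt /IHq[a aE]]].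
  exists (fun=> 0) => R phi y; rewrite /ev big_nil /color_expansion big1 // => g _.
    by rewrite rmorph0 mul0r.
have [b bE] := multilinear_term_expand d c0 pt.
exists (fun g => ct.1 * b g + a g) => R phi y.
rewrite ev_cons aE bE /color_expansion mulr_sumr -big_split /=.
by apply: eq_bigr => g _; rewrite rmorphD rmorphM mulrDl mulrA.
Qed.

Definition stab d : {set {perm C}} := [set s : {perm C} | [forall j, d (s j) == d j]].

Lemma stabP d (s : {perm C}) : reflect (forall j, d (s j) = d j) (s \in stab d).
Proof. by rewrite inE; apply: (iffP forallP) => ds j; apply/eqP. Qed.

Lemma stabV d (s : {perm C}) : (s^-1%g \in stab d) = (s \in stab d).
Proof.
suff sub u : u \in stab d -> u^-1%g \in stab d.
  by apply/idP/idP => /sub; rewrite ?invgK.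
by move=> /stabP du; apply/stabP => j; rewrite -[in RHS](permKV u j) du.
Qed.

Definition recolor m (s : {perm C}) (h : {ffun 'I_m -> C}) : {ffun 'I_m -> C} :=
  [ffun i => s (h i)].

Definition surjective m (h : {ffun 'I_m -> C}) := [forall j, [exists i, h i == j]].

(** The value of a multilinear polynomial at these basis vectors is one of its
coefficients ([expansion_indicator]). *)
Definition indicator m (h : {ffun 'I_m -> C}) (i : nat) (c : C) : F :=
  if insub i is Some i' then (h i' == c)%:R else 0.

Lemma expansion_indicator m (a : {ffun 'I_m -> C} -> F) h :
  color_expansion a idfun (indicator h) = a h.
Proof.
rewrite /color_expansion (bigD1 h) //= [X in _ * X]big1 ?mulr1; last first.
  by move=> i _; rewrite /indicator valK eqxx.
rewrite big1 ?addr0 // => g gh.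
have [i gi] : exists i, g i != h i.
  by apply/existsP; rewrite -negb_forall; apply: contra gh => /eqfunP/ffunP->.
by rewrite (bigD1 i) //= /indicator valK eq_sym (negbTE gi) mul0r mulr0.
Qed.

(** A permutation that fixes a surjective coloring is the identity; hence the
indicator function of a set of representatives of the orbits has the required
property. *)
Lemma free_orbit_selector d m : exists b : {ffun 'I_m -> C} -> F,
  forall h, surjective h -> \sum_(s in stab d) b (recolor s h) = 1.
Proof.
pose orb h := [set recolor s h | s in stab d] : {set {ffun 'I_m -> C}}.
(* [can h] depends only on the orbit of [h] *)
pose can h := odflt h [pick g in orb h].
exists (fun h => (can h == h)%:R) => h hsurj.
have stab1 : 1%g \in stab d by apply/stabP => j; rewrite perm1.
have stabM s u : s \in stab d -> u \in stab d -> (s * u)%g \in stab d.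
  by move=> /stabP ds /stabP du; apply/stabP => j; rewrite permM du ds.
have recM s u g : recolor s (@recolor m u g) = recolor (u * s)%g g.
  by apply/ffunP => i; rewrite !ffunE permM.
have orbE s : s \in stab d -> orb (recolor s h) = orb h.
  move=> sG; apply/setP => g; apply/imsetP/imsetP => -[u uG ->].
    by exists (s * u)%g; [apply: stabM | rewrite recM].
  exists (s^-1 * u)%g; first by apply: stabM; rewrite ?stabV.
  by rewrite recM mulgA mulgV mul1g.
have [u uG canE] : exists2 u, u \in stab d & can h = recolor u h.
  rewrite /can; case: pickP => [g /imsetP[u uG ->]|/(_ h) /imsetP[]]; first by exists u.
  by exists 1%g => //; apply/ffunP => i; rewrite ffunE perm1.
have canS s : s \in stab d -> can (recolor s h) = can h.
  move=> sG; rewrite /can orbE //; case: pickP => // /(_ (recolor u h)) /imsetP[].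
  by exists u.
rewrite (bigD1 u) //= canS // canE eqxx big1 ?addr0 // => s /andP[sG su].
rewrite canS // canE; case: eqP => // rE; case/eqP: su; apply/permP => j.
have /forallP/(_ j)/existsP[i /eqP <-] := hsurj.
by move/ffunP/(_ i): rE; rewrite !ffunE.
Qed.

(** The coefficients of [G] are invariant under [stab d] because traces are,
and they vanish on the colorings that omit a color [j], as one sees by setting
coordinate [j] to zero.  The coefficients on the remaining colorings are kept
for one representative of each orbit. *)
Lemma lead_transfer d (c0 : C) m G : lead d 0 m G ->
  (forall j R phi y, (forall i, y i j = 0) -> G R phi y = 0) ->
  exists b : {ffun 'I_m -> C} -> F, forall R phi y,
    G R phi y = \sum_(s in stab d) color_expansion b phi (fun i j => y i (s j)).
Proof.
move=> Gl G0; have [a aE] := lead_expand c0 Gl.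
have [b bP] := free_orbit_selector d m.
have a_nonsurj h : ~~ surjective h -> a h = 0.
  rewrite negb_forall => /existsP[j]; rewrite negb_exists => /forallP hj.
  rewrite -expansion_indicator -aE; apply: (G0 j) => i.
  by rewrite /indicator; case: insubP => // i' _ _; rewrite (negbTE (hj i')).
have a_stab s h : s \in stab d -> a (recolor s h) = a h.
  move/stabP => ds; rewrite -!expansion_indicator -!aE -(lead_perm Gl ds).
  rewrite !aE; apply: eq_bigr => g _; congr (_ * _); apply: eq_bigr => i _.
  rewrite /indicator; case: insubP => // i' _ _.
  by rewrite ffunE (inj_eq perm_inj).
exists (fun g => a g * b g) => R phi y.
have recK (s : {perm C}) : cancel (@recolor m s) (recolor s^-1%g).
  by move=> h; apply/ffunP => i; rewrite !ffunE permK.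
have transl s : s \in stab d ->
    color_expansion (fun g => a g * b g) phi (fun i j => y i (s^-1%g j)) =
    \sum_h phi (a h * b (recolor s h)) * \prod_(i < m) y i (h i).
  move=> sG; rewrite /color_expansion (reindex_inj (can_inj (recK s))).
  apply: eq_bigr => h _; rewrite a_stab //; congr (_ * _).
  by apply: eq_bigr => i _; rewrite ffunE permK.
rewrite (reindex_inj (@invg_inj {perm C})) /=.
under eq_bigl do rewrite stabV.
rewrite (eq_bigr _ transl) exchange_big aE; apply: eq_bigr => h _ /=.
rewrite -mulr_suml -rmorph_sum -mulr_sumr /=.
have [/bP->|/a_nonsurj->] := boolP (surjective h); by rewrite ?mulr1 ?mul0r.
Qed.
End Transfer.

(** * Trace polynomials with recolored coordinates *)

Section Mixed.
Variables (F : fieldType) (C : finType) (d : C -> F).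
Implicit Types (w : word) (t : term) (p q : tpoly F).
Local Notation ufun := (ufun F C).

Definition sfun := forall R : comNzRingType, {rmorphism F -> R} ->
  (nat -> C -> R) -> (C -> C) -> R.

Definition mixed_monomial := (term * seq (nat * C))%type.

Definition ev_mixed (R : comNzRingType) (phi : {rmorphism F -> R})
    (y : nat -> C -> R) (s : C -> C) (u : mixed_monomial) : R :=
  ev_term phi d y u.1 * \prod_(x <- u.2) y x.1 (s x.2).

(** Polynomials in the traces and in the recolored coordinates [y i (s j)],
with at most [n] traces in each monomial.  The map [s] is a variable: it is
summed over in [ev_of_mixed]. *)
Definition mixed n (Psi : sfun) :=
  exists l : seq (F * mixed_monomial),
    all (fun u => (size u.2.1 <= n)%N) l /\
    forall R phi y s, Psi R phi y s = \sum_(u <- l) phi u.1 * ev_mixed phi y s u.2.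

Lemma eq_mixed n (Psi Psi' : sfun) : mixed n Psi ->
  (forall R phi y s, Psi' R phi y s = Psi R phi y s) -> mixed n Psi'.
Proof. by move=> [l [ln lE]] E; exists l; split=> // R phi y s; rewrite E. Qed.

Lemma mixed_monom n (c : F) (u : mixed_monomial) : (size u.1 <= n)%N ->
  mixed n (fun R phi y s => phi c * ev_mixed phi y s u).
Proof.
move=> un; exists [:: (c, u)]; split; first by rewrite /= un.
by move=> R phi y s; rewrite big_seq1.
Qed.

Lemma mixedS n n' Psi : (n <= n')%N -> mixed n Psi -> mixed n' Psi.
Proof.
move=> nn' [l [ln lE]]; exists l; split=> //.
by apply: sub_all ln => u /leq_trans->.
Qed.

Lemma mixedD n (Psi Psi' : sfun) : mixed n Psi -> mixed n Psi' ->
  mixed n (fun R phi y s => Psi R phi y s + Psi' R phi y s).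
Proof.
move=> [l [ln lE]] [l' [ln' lE']]; exists (l ++ l').
by rewrite all_cat ln ln'; split=> // R phi y s; rewrite big_cat lE lE'.
Qed.

Lemma mixedM n n' (Psi Psi' : sfun) : mixed n Psi -> mixed n' Psi' ->
  mixed (n + n') (fun R phi y s => Psi R phi y s * Psi' R phi y s).
Proof.
move=> [l [ln lE]] [l' [ln' lE']].
exists [seq (a.1 * b.1, (a.2.1 ++ b.2.1, a.2.2 ++ b.2.2)) | a <- l, b <- l'].
split.
  apply/allP => u /allpairsPdep[a [b [al bl ->]]] /=.
  by rewrite size_cat leq_add // ?(allP ln _ al) ?(allP ln' _ bl).
move=> R phi y s; rewrite lE lE' big_allpairs_dep mulr_suml.
apply: eq_bigr => a _; rewrite mulr_sumr; apply: eq_bigr => b _ /=.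
rewrite /ev_mixed /= ev_term_cat big_cat rmorphM /= mulrACA; congr (_ * _); apply: mulrACA.
Qed.

Lemma mixed_const n (c : F) : mixed n (fun R phi y s => phi c).
Proof.
apply: eq_mixed (mixed_monom c (u := ([::], [::])) (leq0n n)) _ => R phi y s.
by rewrite /ev_mixed /ev_term /= !big_nil !mulr1.
Qed.

Lemma mixedZ n (c : F) (Psi : sfun) : mixed n Psi ->
  mixed n (fun R phi y s => phi c * Psi R phi y s).
Proof. exact: mixedM (mixed_const 0 c). Qed.

Lemma mixed_sum n (J : Type) (r : seq J) (Psi : J -> sfun) :
  (forall j, mixed n (Psi j)) ->
  mixed n (fun R phi y s => \sum_(j <- r) Psi j R phi y s).
Proof.
move=> PsiP; elim: r => [|j r IHr].
  apply: eq_mixed (mixed_const n 0) _ => R phi y s.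
  by rewrite big_nil rmorph0.
apply: eq_mixed (mixedD (PsiP j) IHr) _ => R phi y s.
by rewrite big_cons.
Qed.

Lemma mixed_prod n (J : Type) (r : seq J) (Psi : J -> sfun) :
  (forall j, mixed n (Psi j)) ->
  mixed (size r * n) (fun R phi y s => \prod_(j <- r) Psi j R phi y s).
Proof.
move=> PsiP; elim: r => [|j r IHr].
  apply: eq_mixed (mixed_const _ 1) _ => R phi y s.
  by rewrite big_nil rmorph1.
rewrite mulSn; apply: eq_mixed (mixedM (PsiP j) IHr) _ => R phi y s.
by rewrite big_cons.
Qed.

Definition along (G : ufun) : sfun := fun R phi y s => G R phi (fun i j => y i (s j)).

Lemma mixed_lead o m G : lead d o m G -> mixed 0 (along G).
Proof.
move=> [q [_ qE]].
have mixed_tr w : mixed 0 (along (fun R phi y => tr phi d y w)).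
  apply: (@eq_mixed _ (fun R phi y s => \sum_j phi (d j) *
            ev_mixed phi y s ([::], [seq (i, j) | i <- w]))).
    by apply: mixed_sum => j; apply: mixed_monom.
  move=> R phi y s; apply: eq_bigr => j _; congr (_ * _).
  by rewrite /ev_mixed /ev_term big_nil mul1r big_map.
apply: (@eq_mixed _ (fun R phi y s => \sum_(ct <- q) phi ct.1 *
   \prod_(w <- ct.2) along (fun R phi y => tr phi d y w) phi y s)).
  apply: mixed_sum => ct; apply: mixedZ; rewrite -(muln0 (size ct.2)).
  exact: mixed_prod.
by move=> R phi y s; rewrite /along qE.
Qed.

Lemma mixed_expansion m a : mixed 0 (along (@color_expansion F C m a)).
Proof.
apply: (@eq_mixed _ (fun R phi y s => \sum_g phi (a g) * ev_mixed phi y s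
         ([::], [seq (val i, g i) | i <- index_enum 'I_m]))).
  by apply: mixed_sum => g; apply: mixed_monom.
move=> R phi y s; apply: eq_bigr => g _; congr (_ * _).
by rewrite /ev_mixed /ev_term big_nil mul1r big_map.
Qed.

Definition reassign (s : C -> C) j c : C -> C := fun l => if l == j then c else s l.

(** In a monomial, the coordinates of color [j] are the only ones that depend
on [c]; their weighted sum over [c] is one trace. *)
Lemma mixed_average Psi j : mixed 0 Psi ->
  mixed 1 (fun R phi y s => \sum_c phi (d c) * Psi R phi y (reassign s j c)).
Proof.
move=> [l [l0 lE]].
pose u' (u : mixed_monomial) : mixed_monomial :=
  ([:: [seq x.1 | x <- u.2 & x.2 == j]], [seq x <- u.2 | x.2 != j]).
exists [seq (u.1, u' u.2) | u <- l]; split; first by apply/allP => _ /mapP[u _ ->].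
move=> R phi y s; rewrite big_map.
under [LHS]eq_bigr do rewrite lE mulr_sumr.
rewrite exchange_big; apply: eq_big_seq => u /(allP l0) u0 /=.
rewrite /ev_mixed /= /ev_term big_seq1 /tr mulr_suml mulr_sumr.
apply: eq_bigr => c _; move: u0; rewrite leqn0 size_eq0 => /eqP->.
rewrite big_nil mul1r mulrCA -mulrA; congr (_ * (_ * _)).
rewrite (bigID (fun x => x.2 == j)) big_map !big_filter /=.
congr (_ * _); apply: eq_bigr => x; rewrite /reassign; first by move->.
by move/negbTE->.
Qed.

(** For a monomial, the sum over all [s] is a product over the colors [c]: the
coordinates of color [c] contribute the trace of their product. *)
Lemma ev_of_mixed n Psi : mixed n Psi -> exists p : tpoly F,
  all (fun ct => (size ct.2 <= n + #|C|)%N) p /\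
  forall (R : comNzRingType) (phi : {rmorphism F -> R}) (y : nat -> C -> R),
    \sum_(s : {ffun C -> C}) (\prod_l phi (d (s l))) * Psi R phi y s
    = ev phi d y p.
Proof.
move=> [l [ln lE]].
pose t' (u : mixed_monomial) : term :=
  u.1 ++ [seq [seq x.1 | x <- u.2 & x.2 == c] | c <- enum C].
exists [seq (u.1, t' u.2) | u <- l]; split.
  apply/allP => _ /mapP[u /(allP ln) un ->] /=.
  by rewrite size_cat size_map -cardE leq_add2r.
move=> R phi y; rewrite /ev big_map.
under [LHS]eq_bigr do rewrite lE mulr_sumr.
rewrite exchange_big; apply: eq_bigr => u _ /=.
rewrite ev_term_cat /ev_mixed.
under eq_bigr do rewrite mulrCA [X in _ * X]mulrCA.
rewrite -!mulr_sumr; congr (_ * (_ * _)).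
rewrite /ev_term big_map big_enum /= /tr bigA_distr_bigA /=.
apply: eq_bigr => s _; rewrite big_split; congr (_ * _).
under [RHS]eq_bigr do rewrite big_map big_filter.
rewrite (exchange_big_dep xpredT) //=; apply: eq_bigr => x _.
by rewrite (big_pred1 x.2) // => c; rewrite eq_sym.
Qed.

End Mixed.

(** * The averaging identity *)

Section Step.
Variables (F : fieldType) (C : finType) (d : C -> F).
Local Notation ufun := (ufun F C).

Lemma sum_ffun_perm (R : nmodType) (Phi : {ffun C -> C} -> R) :
  (forall s : {ffun C -> C}, ~~ injectiveb s -> Phi s = 0) ->
  \sum_s Phi s = \sum_(s : {perm C}) Phi [ffun l => s l].
Proof.
move=> Phi0; pose h (s : {perm C}) := [ffun l => s l].
have h_inj : injective h.
  by move=> s s' /ffunP E; apply/permP => l; have := E l; rewrite !ffunE.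
rewrite (bigID (fun s : {ffun C -> C} => injectiveb s)) /= addrC big1 // add0r.
transitivity (\sum_(s in h @: [set: {perm C}]) Phi s).
  apply: eq_bigl => s; apply/idP/imsetP => [sI|[u _ ->]].
    exists (perm (injectiveP _ sI)) => //.
    by apply/ffunP => l; rewrite ffunE permE.
  by apply/injectiveP => l l'; rewrite !ffunE; apply: perm_inj.
rewrite big_imset; last exact: in2W.
by apply: eq_bigl => s; rewrite inE.
Qed.

(** When [G] vanishes at collisions of color [j] and [s] is a permutation, only
[c = s j] contributes to the sum, which thus has the value
[d (s j) * along G s].  The separator is then [d (s j) - d n] times
[along G s]: it kills the permutations that give [j] the weight of [n].  In the
case [d n = d j] the plain factor [along G s] is used; it kills the maps [s]
that identify [j] with another color. *)
Definition separator j n (G : ufun) : sfun F C := fun R phi y s =>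
  if d n == d j then along G phi y s
  else \sum_c phi (d c) * along G phi y (reassign s j c)
       - phi (d n) * along G phi y s.

Definition separator_weight j n : F := if d n == d j then 1 else d j - d n.

Definition vanish_at_collision j (G : ufun) := forall l, l != j ->
  forall R phi y, (forall i, y i j = y i l) -> G R phi y = 0.

Lemma separator_mixed j n G : mixed d 0 (along G) -> mixed d 1 (separator j n G).
Proof.
move=> GP; rewrite /separator; case: eqP => _; first exact: mixedS GP.
apply: eq_mixed (mixedD (mixed_average j GP) (mixedZ (- d n) (mixedS (leq0n 1) GP))) _.
by move=> R phi y s; rewrite rmorphN mulNr.
Qed.

Definition extensional (G : ufun) := forall (R : comNzRingType)
    (phi : {rmorphism F -> R}) (y y' : nat -> C -> R),
  (forall i j, y i j = y' i j) -> G R phi y = G R phi y'.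

Lemma lead_extensional o m G : lead d o m G -> extensional G.
Proof.
move=> [q [_ qE]] R phi y y' yE; rewrite !qE.
apply: eq_bigr => ct _; congr (_ * _); apply: eq_bigr => w _.
by apply: eq_tr => i j _.
Qed.

Lemma separator_perm j n G (u : {perm C}) (s : C -> C) :
  extensional G -> vanish_at_collision j G -> s =1 u ->
  forall (R : comNzRingType) (phi : {rmorphism F -> R}) y,
    separator j n G phi y s =
    phi (if d n == d j then 1 else d (u j) - d n) * along G phi y u.
Proof.
move=> Gext G0 su R phi y; rewrite /separator.
have -> : along G phi y s = along G phi y u.
  by apply: Gext => i l; rewrite su.
case: ifP => _; first by rewrite rmorph1 mul1r.
rewrite (bigD1 (u j)) //= big1 ?addr0 => [|c cj]; last first.
  have lj : u^-1%g c != j by apply: contra cj => /eqP <-; rewrite permKV.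
  rewrite [along _ _ _ _](G0 _ lj) ?mulr0 // => i.
  by rewrite /reassign eqxx (negbTE lj) su permKV.
rewrite rmorphB mulrBl; congr (_ * _ - _).
by apply: Gext => i l; rewrite /reassign su; case: eqP => // ->.
Qed.

(** A map [s] that identifies two colors [j] and [l] is killed by the separator
of index [(j, j)], and a permutation [s] with [d (s j) != d j] by the separator
of index [(j, s j)].  On [stab d], all factors except [f = color_expansion b]
are constant. *)
Lemma averaging_identity (G1 : ufun) m (b : {ffun 'I_m -> C} -> F)
    (G : C -> C -> ufun) :
  (forall R phi y, G1 R phi y =
     \sum_(s in stab d) color_expansion b phi (fun i j => y i (s j))) ->
  (forall j n, extensional (G j n)) ->
  (forall j n, vanish_at_collision j (G j n)) ->
  (forall (s : {perm C}), s \in stab d -> forall j n R phi y,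
     G j n R phi (fun i l => y i (s l)) = G j n R phi y) ->
  forall (R : comNzRingType) (phi : {rmorphism F -> R}) (y : nat -> C -> R),
  \sum_(s : {ffun C -> C}) (\prod_l phi (d (s l))) *
    (along (@color_expansion F C m b) phi y s *
     \prod_x separator x.1 x.2 (G x.1 x.2) phi y s) =
  phi ((\prod_l d l) * \prod_x separator_weight x.1 x.2) *
    (G1 R phi y * \prod_x G x.1 x.2 R phi y).
Proof.
move=> G1E Gext G0 Gstab R phi y.
rewrite sum_ffun_perm => [|s]; last first.
  case/injectivePn => j [l jl sjl].
  rewrite (bigD1 (j, j)) //= {1}/separator eqxx /along (G0 j j l) ?mul0r ?mulr0 //.
    by rewrite eq_sym.
  by move=> i; rewrite sjl.
have sepE (u : {perm C}) j n := separator_perm n (Gext j n) (G0 j n)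
   (ffunE (fun l => u l)) phi y.
rewrite (bigID (fun u => u \in stab d)) /= [X in _ + X]big1 ?addr0 => [|u]; last first.
  rewrite inE negb_forall => /existsP[j uj].
  rewrite (bigD1 (j, u j)) //= sepE (negbTE uj) subrr rmorph0.
  by rewrite !mul0r !mulr0.
rewrite G1E mulr_suml mulr_sumr; apply: eq_bigr => u uG.
have ud j : d (u j) = d j by move/stabP: uG.
rewrite mulrCA [RHS]mulrCA; congr (_ * _).
  apply: eq_bigr => g _; congr (_ * _); apply: eq_bigr => i _.
  by rewrite ffunE.
rewrite rmorphM rmorph_prod -mulrA; congr (_ * _).
  by apply: eq_bigr => l _; rewrite ffunE ud.
rewrite rmorph_prod -big_split; apply: eq_bigr => -[j n] _ /=.
by rewrite sepE ud /separator_weight /along Gstab.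
Qed.

(** Extracting the multilinear part and replacing the traces of empty words by
their values puts a relation in the required form: the leading term [q] is
unaffected, and the number of traces does not increase. *)
Lemma trace_identity_of_relation m q p K :
  (0 < m)%N -> trace_monic 0 m q ->
  (K < m)%N -> all (fun ct => (size ct.2 <= K)%N) p ->
  (forall R phi y, @ev F C R phi d y q + ev phi d y p = 0) ->
  trace_identity d.
Proof.
move=> m0 [q' [qE q'low]] Km pK q0.
pose r := [seq ct <- q ++ p | perm_eq (flatten ct.2) (iota 0 m)].
have r0 : forall R phi y, @ev F C R phi d y r = 0.
  by apply: ev_multilinear_part => R phi y; rewrite ev_cat q0.
exists m, [seq remove_empty_words d ct | ct <- r]; split=> //; split; last first.
  by move=> R phi y; rewrite ev_remove_empty_words r0.
exists [seq remove_empty_words d ct | ct <- q' ++ p & perm_eq (flatten ct.2) (iota 0 m)].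
split.
  rewrite /r qE /= flatten_traces_of perm_refl /=; congr (_ :: _).
  have nonnil : {in traces_of 0 m, forall w, w != [::]}.
    by move=> w wt; apply: contraNneq (traces_of_nonempty 0 m) => <-.
  rewrite /remove_empty_words /=; congr (_, _).
    by rewrite mul1r big_seq_cond big1 // => w /andP[/nonnil/negbTE->].
  by apply/all_filterP/allP.
apply/allP => _ /mapP[[c t] + ->]; rewrite mem_filter mem_cat /= => /andP[pt ct].
have flattenE : flatten [seq w <- t | w != [::]] = flatten t.
  by elim: (t) => //= -[|i w] t' /= ->.
rewrite /lower_term /= flattenE pt andbT mem_filter eqxx andbT size_filter.
apply: leq_ltn_trans (count_size _ _) _.
case/orP: ct => [/(allP q'low)/and3P[] //|/(allP pK) /=tK].
exact: leq_ltn_trans tK Km.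
Qed.

Lemma trace_identity_step :
  (0 < #|C|)%N -> (forall j, d j != 0) ->
  (forall j, trace_identity (drop_color d j)) ->
  (forall j l, j != l -> trace_identity (merge_colors d j l)) ->
  trace_identity d.
Proof.
move=> /card_gt0P[c0 _] d0 IHdrop IHmerge.
pose K := (0 + size (index_enum (C * C)%type) * 1 + #|C|)%N.
(* The index in ['I_K.+1] only serves to provide more than [K] factors, so that
[G1] has more than [K] variables. *)
pose S1 (x : C * 'I_K.+1) (G : ufun) := forall R phi y,
  (forall i, y i x.1 = 0) -> G R phi y = 0.
have [|m1 [H [m1K Hl HS]]] := @lead_prod _ _ d _ S1 _ (enum {: C * 'I_K.+1}) 0 (enum_uniq _).
  move=> x o; have [m [G [m0 Gl G0]]] := lead_of_identity d (IHdrop x.1) o.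
  exists m, G; split=> // R phi y yx; apply: G0 => w wn; exact: tr_drop.
have [|b bE] := lead_transfer c0 Hl.
  move=> j R phi y yj; rewrite (big_rem (j, ord0)) ?mem_enum //=.
  by rewrite (HS (j, ord0)) ?mem_enum // mul0r.
(* For [j = l] any leading expression will do. *)
pose S2 (x : C * C * C) (G : ufun) := (exists o m, lead d o m G) /\
  (x.1.1 != x.2 -> forall R phi y, (forall i, y i x.1.1 = y i x.2) -> G R phi y = 0).
have [|m2 [H2 [_ Hl2 HS2']]] := @lead_prod _ _ d _ S2 _
    (enum {: C * C * C}) m1 (enum_uniq _).
  move=> x o; have [xE|xE] := eqVneq x.1.1 x.2.
    have [m [G [m0 Gl _]]] := lead_of_identity d (IHdrop x.1.1) o.
    by exists m, G; split=> //; split; [exists o, m | rewrite xE eqxx].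
  have [m [G [m0 Gl G0]]] := lead_of_identity d (IHmerge _ _ xE) o.
  exists m, G; split=> //; split; first by exists o, m.
  by move=> _ R phi y yE; apply: G0 => w _; apply: tr_merge.
have HS2 x : S2 x (H2 x) by apply: HS2'; rewrite mem_enum.
pose G j n : ufun := fun R phi y => \prod_l H2 (j, n, l) R phi y.
have Gext j n : extensional (G j n).
  move=> R phi y y' yE; apply: eq_bigr => l _.
  by have [[o [m /lead_extensional E]] _] := HS2 (j, n, l); apply: E.
have G0 j n : vanish_at_collision j (G j n).
  move=> l lj R phi y yE; rewrite /G (bigD1 l) //=.
  have [_ -> //] := HS2 (j, n, l); first by rewrite mul0r.
  by rewrite eq_sym.
have Gstab (s : {perm C}) : s \in stab d -> forall j n R phi y,
     G j n R phi (fun i l => y i (s l)) = G j n R phi y.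
  move=> /stabP ds j n R phi y; apply: eq_bigr => l _.
  by have [[o [m /lead_perm E]] _] := HS2 (j, n, l); apply: E.
have Gmix j n : mixed d 0 (along (G j n)).
  rewrite -(muln0 (size (index_enum C))); apply: mixed_prod => l.
  by have [[o [m /mixed_lead E]] _] := HS2 (j, n, l).
have [p [pK pE]] := ev_of_mixed (mixedM (mixed_expansion d b)
  (mixed_prod (index_enum (C * C)%type)
     (fun x => separator_mixed x.1 x.2 (Gmix x.1 x.2)))).
have [q [qm Gq]] := lead_mul Hl Hl2.
pose kappa := (\prod_l d l) * \prod_(x : C * C) separator_weight x.1 x.2.
have kappa0 : kappa != 0.
  rewrite mulf_neq0 //; apply/prodf_neq0 => // -[j n] _ /=.
  rewrite /separator_weight; case: ifP => [_|/negbT nj]; first exact: oner_neq0.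
  by rewrite subr_eq0 eq_sym.
have m_big : (K < m1 + m2)%N.
  apply: leq_trans (leq_addr _ _); apply: leq_trans m1K.
  rewrite -cardE card_prod card_ord leq_pmull //.
  by apply/card_gt0P; exists c0.
apply: (@trace_identity_of_relation (m1 + m2) q (tpoly_scale (- kappa^-1) p) K) => //.
  exact: leq_ltn_trans m_big.
  by rewrite /tpoly_scale all_map.
move=> R phi y; rewrite ev_scale -pE.
rewrite (averaging_identity
  (G1 := fun R phi y => \prod_(j <- enum {: C * 'I_K.+1}) H j R phi y)) //.
rewrite -Gq -/kappa rmorphN mulNr [phi kappa^-1 * _]mulrA -rmorphM mulVf // rmorph1 mul1r.
apply/eqP; rewrite subr_eq0; apply/eqP; congr (_ * _).
rewrite big_enum /G (pair_bigA _ (fun x l => H2 (x.1, x.2, l) R phi y)) /=.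
by apply: eq_bigr => -[[j n] l].
Qed.
End Step.

(** * Existence of the identity *)

Section Existence.
Variable F : fieldType.

Definition support (C : finType) (d : C -> F) : {pred C} := [pred j | d j != 0].

(** A formal identity does not mention the colors, so colors of weight zero can
be left out. *)
Lemma trace_identity_support (C : finType) (d : C -> F) :
  @trace_identity F {j : C | j \in support d} (fun j => d (val j)) -> trace_identity d.
Proof.
move=> [m [q [m0 [qm q0]]]]; exists m, q; split=> //; split=> // R phi y.
rewrite -[RHS](q0 R phi (fun i j => y i (val j))).
apply: eq_bigr => ct _; congr (_ * _); apply: eq_bigr => w _.
rewrite /tr (bigID (mem (support d))) /= addrC big1 => [|j].
  rewrite add0r.
  by rewrite big_sub.
by move=> /negPn/eqP->; rewrite rmorph0 mul0r.
Qed.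

Lemma trace_identity_exists (C : finType) (d : C -> F) : trace_identity d.
Proof.
have [n] := ubnP #|support d|.
elim: n C d => // n IHn C d; rewrite ltnS => dn.
have [d0|d_gt0] := posnP #|support d|.
  exists 1%N, [:: (1, traces_of 0 1)]; split=> //; split; first by exists [::].
  move=> R phi y; rewrite /ev big_seq1 /ev_term big_seq1 /tr big1 ?mulr0 // => j _.
  have := card0_eq d0 j; rewrite !inE => /negbFE/eqP->.
  by rewrite rmorph0 mul0r.
apply: trace_identity_support.
pose C' : finType := {j : C | j \in support d}.
have cardC' : #|C'| = #|support d| by rewrite card_sig.
have small (d' : C' -> F) j : d' j = 0 -> trace_identity d'.
  move=> d'j; apply: IHn; apply: leq_trans dn; rewrite -cardC'.
  apply: (@leq_ltn_trans #|predC1 j|); last by rewrite cardC1 prednK // cardC'.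
  by apply/subset_leq_card/subsetP => l; rewrite !inE; apply: contraNneq => ->; rewrite d'j.
apply: trace_identity_step; first by rewrite cardC'.
- by move=> [].
- by move=> j; apply: (small _ j); rewrite /drop_color eqxx.
- by move=> j l jl; apply: (small _ l); rewrite /merge_colors eqxx.
Qed.
End Existence.

(** * Evaluation at diagonal matrices *)

Section Matrices.
Variables (F : fieldType) (k m : nat) (d : 'I_k -> F).

Definition lift_poly (f : trace_poly F m) : tpoly F :=
  [seq (ct.1, [seq [seq val i | i <- w] | w <- ct.2]) | ct <- f].

Definition diagonal_entries (R : comNzRingType) (Y : 'I_m -> 'M[R]_k)
    (i : nat) (j : 'I_k) : R :=
  if insub i is Some i' then Y i' j j else 0.

Lemma eval_trace_poly_diag (R : comNzRingType) (phi : {rmorphism F -> R})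
    (Y : 'I_m -> 'M[R]_k) f : (forall i, is_diag_mx (Y i)) ->
  eval_trace_poly phi d Y f = ev phi d (diagonal_entries Y) (lift_poly f).
Proof.
move=> Yd; rewrite /ev big_map; apply: eq_bigr => ct _; congr (_ * _).
rewrite /ev_term big_map; apply: eq_bigr => w _; apply: eq_bigr => j _.
congr (_ * _); rewrite /eval_monomial big_map.
elim: w => [|i w IHw]; first by rewrite !big_nil -idmxE mxE eqxx.
rewrite !big_cons -IHw -mulmxE mxE (bigD1 j) //= big1 ?addr0 => [|l lj].
  by rewrite /diagonal_entries valK.
by have /is_diag_mxP-> := Yd i; rewrite ?mul0r // eq_sym.
Qed.

Lemma lift_prod_of_traces : lift_poly (prod_of_traces F m) = [:: (1, traces_of 0 m)].
Proof. by rewrite /lift_poly /= /traces_of -val_enum_ord -!map_comp. Qed.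

Definition lower_poly (p : tpoly F) : trace_poly F m :=
  [seq (ct.1, [seq pmap insub w | w <- ct.2]) | ct <- p].

Lemma pmap_insubK (t : term) w : perm_eq (flatten t) (iota 0 m) -> w \in t ->
  [seq val i | i <- pmap (insub : nat -> option 'I_m) w] = w.
Proof.
move=> pt wt; rewrite (pmap_filter (@insubK _ _ _)); apply/all_filterP/allP => i iw.
have : i \in flatten t by apply/flattenP; exists w.
by rewrite (perm_mem pt) mem_iota /= add0n => im; rewrite insubT.
Qed.

Lemma lower_polyK p : all (fun ct => lower_term 0 m ct.2) p ->
  lift_poly (lower_poly p) = p.
Proof.
move=> pP; rewrite /lift_poly /lower_poly -map_comp map_id_in // => -[c t].
move=> /(allP pP)/and3P[_ _ /= pt]; congr (_, _).
by rewrite -map_comp map_id_in // => w /(pmap_insubK pt).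
Qed.
End Matrices.
Unset Implicit Arguments.

Theorem mainTheorem2 (F : fieldType) (k : nat) (hk : (1 <= k)%N)
    (d : 'I_k -> F) (hd : forall j, d j != 0) :
  exists m : nat, (1 <= m)%N /\
    exists p : trace_poly F m,
      (forall ct, ct \in p ->
         is_trace_term ct.2 /\ (num_traces ct.2 < m)%N)
      /\ satisfies_trace_identity d (prod_of_traces F m) p.
Proof.
have [m [q [m0 [[p [-> plow]] q0]]]] := trace_identity_exists d.
have p'low : all (fun ct => lower_term 0 m ct.2) (tpoly_scale (-1) p).
  by rewrite /tpoly_scale all_map.
have identity (R : comNzRingType) (phi : {rmorphism F -> R}) (Y : 'I_m -> 'M[R]_k) :
    (forall i, is_diag_mx (Y i)) ->
    eval_trace_poly phi d Y (prod_of_traces F m) =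
    eval_trace_poly phi d Y (lower_poly m (tpoly_scale (-1) p)).
  move=> Yd; rewrite !eval_trace_poly_diag // lift_prod_of_traces lower_polyK //.
  have /eqP := q0 _ phi (diagonal_entries Y).
  by rewrite ev_cons addr_eq0 ev_scale rmorphN1 mulN1r /ev big_seq1 => /eqP.
exists m; split=> //; exists (lower_poly m (tpoly_scale (-1) p)); split.
  move=> ct ctp; have [ct' ct'p ->] := mapP ctp.
  have /and3P[ltm nt pt] := allP p'low _ ct'p.
  split; last by rewrite /num_traces size_map.
  apply/andP; split=> /=.
    case: (ct'.2) pt => //= /perm_size; rewrite size_iota => m_eq0.
    by rewrite -m_eq0 in m0.
  apply/allP => _ /mapP[w wt ->]; have wK := pmap_insubK pt wt.
  by apply: contraNneq nt => w0; move: wt; rewrite -wK w0.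
split; first by move=> y yd; apply: identity.
by apply: identity => i; apply: diag_mx_is_diag.
Qed.
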